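(* Let $\tau$ be a first-order transduction. There exist a constant $c$ and a function $f:\mathbb N\to\mathbb N$ such that for every graph $G$, every linear order $\sigma$ on the vertices of $G$, and every $D\in\tau(G)$, there exists a lacon-decomposition $(L,\pi)$ of $D$ with $\mathrm{col}_r(L,\pi)\le f(\mathrm{col}_c(G,\sigma))\cdot\mathrm{col}_{cr}(G,\sigma)$ and $\mathrm{wcol}_r(L,\pi)\le f(\mathrm{col}_c(G,\sigma))\cdot\mathrm{wcol}_{cr}(G,\sigma)$ for all $r$.
   Context: A linear order on vertices is an injective map $\pi:V\to\mathbb N$. For a graph and order $\pi$: $u$ is $r$-reachable from $v$ if $\pi(u)\le\pi(v)$ and there is a path of length at most $r$ from $v$ to $u$ all of whose vertices $w$ satisfy $w=u$ or $\pi(w)\ge\pi(v)$; $u$ is weakly $r$-reachable from $v$ if there is a path of length at most $r$ from $v$ to $u$ with $\pi(u)\le\pi(w)$ for all $w$ on the path. $\mathrm{col}_r(G,\pi)$ (resp. $\mathrm{wcol}_r(G,\pi)$) is the maximum over $v$ of the number of vertices $r$-reachable (resp. weakly $r$-reachable) from $v$. Lacon-decomposition: a pair $(L,\pi)$ where $L$ is a bipartite graph with sides $T$ (target vertices) and $H$ (hidden vertices), each hidden vertex is labeled ''0'' or ''1'', $\pi$ is a linear order on $V(L)$ with $\pi(h)<\pi(t)$ for all $h\in H,t\in T$, and for all $t,t'\in T$ we have $N(t)\cap N(t')\neq\emptyset$; the $\pi$-largest vertex of $N(t)\cap N(t')$ is the dominant vertex of $t,t'$. It is a lacon-decomposition of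 a graph $D$ if $V(D)=T$ and for all $t\ne t'\in T$, $tt'\in E(D)$ iff the dominant vertex of $t,t'$ is labeled ''1''. First-order transductions: a basic transduction is a triple $\tau_0=(\chi,\nu,\varphi)$ of first-order formulas with $0,1,2$ free variables; $\tau_0(G)$ is undefined if $G\not\models\chi$, otherwise it is the graph with vertex set $\{v: G\models\nu(v)\}$ and edges $uv$ ($u\neq v$) with $G\models\varphi(u,v)\lor\varphi(v,u)$. A $p$-parameter expansion maps $G$ to the set of all graphs obtained by adding $p$ unary predicates to $G$. An $m$-copy operation maps $G$ to the graph with vertex set $V(G)\times\{1,\dots,m\}$, edges $(v,i)(w,i)$ for $vw\in E(G)$, a binary relation $\sim$ with $(u,i)\sim(v,j)$ iff $u=v$, and unary predicates $Q_i=V(G)\times\{i\}$. A transduction is $\tau=\tau_0\circ\gamma\circ\varepsilon$ with $\varepsilon$ a parameter expansion, $\gamma$ a copy operation, $\tau_0$ a basic transduction; $\tau(G)$ is thus a set of graphs. *)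

(* Defs.v *)
From mathcomp Require Import all_boot.

Set Implicit Arguments.
Unset Strict Implicit.
Unset Printing Implicit Defensive.

Record sgraph := SGraph {
  vertex :> finType;
  adj : rel vertex;
  adj_sym : symmetric adj;
  adj_irrefl : irreflexive adj }.
Arguments adj {s}.

Section GeneralizedColouring.
Variables (G : sgraph) (ord : G -> nat).

Definition gpath (v : G) (s : seq G) (u : G) : bool :=
  [&& path adj v s, uniq (v :: s) & last v s == u].

(* A path with k edges is its start v followed by a k-tuple. *)
Definition reachable (r : nat) (v u : G) : bool :=
  (ord u <= ord v) &&
  [exists k : 'I_r.+1, exists s : k.-tuple G,
     gpath v s u && all (fun w => (w == u) || (ord v <= ord w)) (v :: s)].

Definition wreachable (r : nat) (v u : G) : bool :=
  [exists k : 'I_r.+1, exists s : k.-tuple G,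
     gpath v s u && all (fun w => ord u <= ord w) (v :: s)].

(* The maximum over the empty vertex set is 0. *)
Definition col (r : nat) : nat :=
  \max_(v : G) #|[set u : G | reachable r v u]|.

Definition wcol (r : nat) : nat :=
  \max_(v : G) #|[set u : G | wreachable r v u]|.

End GeneralizedColouring.

(* A bipartite graph with sides T and [hidden] is given by its biadjacency
   relation, so that its vertex set is the disjoint union T + hidden; the label
   "1" is [true].  Making T a parameter lets V(D) = T hold on the nose. *)
Record lacon (T : finType) := Lacon {
  hidden : finType;
  biadj : T -> hidden -> bool;
  label : hidden -> bool;
  lord : T + hidden -> nat;
  lord_inj : injective lord;
  lord_hidden_target : forall (h : hidden) (t : T), lord (inr h) < lord (inl t);
  lacon_common : forall t t' : T, exists h : hidden, biadj t h && biadj t' h }.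
Arguments lord {T}.

Section LaconGraph.
Variables (T : finType) (L : lacon T).

Definition lacon_adj : rel (T + hidden L)%type := fun x y =>
  match x, y with
  | inl t, inr h | inr h, inl t => biadj t h
  | _, _ => false
  end.

Lemma lacon_adj_sym : symmetric lacon_adj.
Proof. by case=> [t|h] [t'|h']. Qed.

Lemma lacon_adj_irrefl : irreflexive lacon_adj.
Proof. by case. Qed.

Definition lacon_graph : sgraph := SGraph lacon_adj_sym lacon_adj_irrefl.

Definition dominant (t t' : T) (h : hidden L) : Prop :=
  biadj t h && biadj t' h /\
  forall h', biadj t h' && biadj t' h' -> lord L (inr h') <= lord L (inr h).

End LaconGraph.

Definition lacon_decomposition_of (D : sgraph) (L : lacon D) : Prop :=
  forall t t' : D, t != t' ->
    (adj t t' <-> exists2 h : hidden L, dominant t t' h & label h).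

(* Structures produced by a p-parameter expansion followed by an m-copy
   operation. *)
Record structure (p m : nat) := Structure {
  dom :> finType;
  edge : rel dom;
  sim : rel dom;
  param : 'I_p -> pred dom;
  layer : 'I_m -> pred dom }.
Arguments edge {p m}.
Arguments sim {p m}.
Arguments param {p m}.
Arguments layer {p m}.

(* Well-scoped formulas whose free variables are among 0, ..., n - 1; the
   quantifier binds variable 0 of its body (de Bruijn indices). *)
Inductive formula (p m n : nat) : Type :=
| FEq of 'I_n & 'I_n
| FEdge of 'I_n & 'I_n
| FSim of 'I_n & 'I_n
| FParam of 'I_p & 'I_n
| FLayer of 'I_m & 'I_n
| FNot of formula p m n
| FAnd of formula p m n & formula p m n
| FEx of formula p m n.+1.

Fixpoint sat p m (A : structure p m) n (f : formula p m n) :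
    n.-tuple A -> bool :=
  match f with
  | FEq i j => fun e => tnth e i == tnth e j
  | FEdge i j => fun e => edge A (tnth e i) (tnth e j)
  | FSim i j => fun e => sim A (tnth e i) (tnth e j)
  | FParam a i => fun e => param A a (tnth e i)
  | FLayer a i => fun e => layer A a (tnth e i)
  | FNot g => fun e => ~~ sat g e
  | FAnd g h => fun e => sat g e && sat h e
  | FEx g => fun e => [exists x : A, sat g (cons_tuple x e)]
  end.

Definition copy_structure p m (G : sgraph) (P : 'I_p -> {set G}) :
    structure p m :=
  @Structure p m (G * 'I_m)%type
    (fun x y => (x.2 == y.2) && adj x.1 y.1)
    (fun x y => x.1 == y.1)
    (fun a x => x.1 \in P a)
    (fun i x => x.2 == i).

Record transduction := Transduction {
  nparam : nat;
  ncopy : nat;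
  chi : formula nparam ncopy 0;
  nu : formula nparam ncopy 1;
  phi : formula nparam ncopy 2 }.

Section BasicTransduction.
Variables (tau : transduction) (A : structure (nparam tau) (ncopy tau)).

Definition out_vertex : finType := {x : A | sat (nu tau) [tuple x]}.

Definition out_adj : rel out_vertex := fun u v =>
  (u != v) && (sat (phi tau) [tuple val u; val v]
               || sat (phi tau) [tuple val v; val u]).

Lemma out_adj_sym : symmetric out_adj.
Proof. by move=> u v; rewrite /out_adj eq_sym orbC. Qed.

Lemma out_adj_irrefl : irreflexive out_adj.
Proof. by move=> u; rewrite /out_adj eqxx. Qed.

Definition basic_transduction : option sgraph :=
  if @sat _ _ A _ (chi tau) [tuple] then Some (SGraph out_adj_sym out_adj_irrefl)
  else None.

End BasicTransduction.

(* [transduces tau G D] is "D is in tau(G)". *)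
Definition transduces (tau : transduction) (G D : sgraph) : Prop :=
  exists P : 'I_(nparam tau) -> {set G},
    basic_transduction (@copy_structure _ (ncopy tau) G P) = Some D.

(* Main.v *)
(* If u is the largest vertex weakly reachable from both t and t', then every
   other common one is weakly reachable from u.  So, if bounded data is attached to
   each vertex, what the vertices weakly reachable from t and from t' have attached
   in common lies in a bounded set K(u).  Hence a relation on t and t' depending
   only on colours and on equalities between attached vertices is determined by u
   and the classes of t and t' over u.  Hidden vertices are triples (u, i, j) with
   i, j classes over u; t is adjacent to (u, i, j) when it weakly reaches u and has
   class i or j over u, and the label says whether classes i and j are joined.

   First-order formulas define relations of this kind, by quantifier elimination.
   For "exists y", let u be the largest common weakly reachable vertex of y and the
   tuple: y may be replaced by any y' of the same class over u whose attached
   vertices outside K(u) avoid those of the tuple.  A bounded family of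
   representatives of each class over u suffices, and can be attached to u. *)
Require Import Defs.
From mathcomp Require Import all_boot zify.

Set Implicit Arguments.
Unset Strict Implicit.
Unset Printing Implicit Defensive.

(** * Walks, reachability and colouring numbers *)

Section Walks.
Variable G : sgraph.
Implicit Types (P Q : pred G) (u v w : G).

(** Vertices may repeat, so walks can be concatenated and reversed freely; [gpath_walkP] recovers
    simple paths by shortening. *)
Definition walk P n v u : Prop :=
  exists s, [/\ path adj v s, last v s = u, all P (v :: s) & size s <= n].

Lemma walk0 P n v : P v -> walk P n v v.
Proof. by move=> Pv; exists [::]; rewrite /= Pv. Qed.

Lemma walk_step P n v w u : P v -> adj v w -> walk P n w u -> walk P n.+1 v u.
Proof. by move=> Pv vw [s [ps ls As Hs]]; exists (w :: s); split; rewrite /= ?vw ?Pv. Qed.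

Lemma walk_cat P m n v w u :
  walk P m v w -> walk P n w u -> walk P (m + n) v u.
Proof.
move=> [s [ps ls /= /andP[Pv As] Hs]] [t [pt lt /= /andP[Pw At] Ht]].
exists (s ++ t); rewrite cat_path last_cat ls ps pt /= Pv all_cat As At size_cat.
by split=> //; exact: leq_add.
Qed.

Lemma walk_sym P n v u : walk P n v u -> walk P n u v.
Proof.
move=> [s [ps <- As Hs]]; exists (rev (belast v s)); split.
- by rewrite rev_path; under eq_path do rewrite adj_sym.
- by case: s {ps As Hs} => //= w s; rewrite rev_cons last_rcons.
- by rewrite -rev_rcons -lastI all_rev.
- by rewrite size_rev size_belast.
Qed.

Lemma walk_mono P Q m n v u :
  m <= n -> {subset P <= Q} -> walk P m v u -> walk Q n v u.
Proof.
move=> mn PQ [s [ps ls As Hs]]; exists s; split=> //; last exact: leq_trans mn.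
exact: sub_all As.
Qed.

Lemma walk_endl P n v u : walk P n v u -> P v.
Proof. by case=> s [_ _ /= /andP[]]. Qed.

Lemma gpath_walkP P r v u :
  reflect (walk P r v u)
    [exists k : 'I_r.+1, exists s : k.-tuple G, gpath v s u && all P (v :: s)].
Proof.
apply: (iffP existsP) => [[k /existsP[s /andP[/and3P[ps _ /eqP ls] As]]]|].
  by exists s; rewrite size_tuple -ltnS.
move=> [s [ps ls As Hs]]; case/shortenP: ps ls => s' ps' us' sub ls.
have Hs' : size s' < r.+1.
  rewrite ltnS; apply: leq_trans Hs.
  by apply: uniq_leq_size; first by case/andP: us'.
exists (Ordinal Hs'); apply/existsP; exists (in_tuple s').
rewrite /gpath ps' us' ls eqxx /=; case/andP: As => -> /allP As.
by apply/allP=> x /sub /As.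
Qed.

Variable ord : G -> nat.

Lemma wreachableP r v u :
  reflect (walk (fun w => ord u <= ord w) r v u) (wreachable ord r v u).
Proof. exact: gpath_walkP. Qed.

Lemma reachableP r v u :
  reflect (ord u <= ord v /\ walk (fun w => (w == u) || (ord v <= ord w)) r v u)
    (reachable ord r v u).
Proof. by apply: (iffP andP) => -[? /gpath_walkP]. Qed.

(* [y] is the first vertex of the walk with [ord y <= ord b]. *)
Lemma walk_split n x a b : ord a <= ord b -> walk (fun w => ord a <= ord w) n x a ->
  exists y, [/\ walk (fun w => (w == y) || (ord b <= ord w)) n x y,
                ord y <= ord b & wreachable ord n y a].
Proof.
move=> ab [s]; elim: s x n => [|w s IHs] x n [/= ps ls As Hs].
  by exists a; rewrite ls; split=> //; [apply: walk0; rewrite eqxx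
    | apply/wreachableP/walk0].
have [xb | bx] := leqP (ord x) (ord b).
  exists x; split=> //; first by apply: walk0; rewrite eqxx.
  by apply/wreachableP; exists (w :: s).
case: n Hs => // n Hs; case/andP: ps => xw ps; case/andP: As => ax As.
have [y [wy yb /wreachableP ya]] := IHs w n (And4 ps ls As Hs).
exists y; split=> //; last by apply/wreachableP; apply: walk_mono ya.
by apply: walk_step wy => //; rewrite (ltnW bx) orbT.
Qed.

(** The walk is cut at its first vertex [y] after the start that is not above [v]; the step spent on
    leaving [v] shortens the remainder by one. *)
Lemma wreachable_step n v a : wreachable ord n.+1 v a ->
  a = v \/ exists2 y, reachable ord n.+1 v y & wreachable ord n y a.
Proof.
case/wreachableP=> -[|w s] [/= ps ls As Hs]; first by left.
right; case/andP: ps => vw ps; case/andP: As => av As.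
have [y [wy yb ya]] := walk_split av (ex_intro _ s (And4 ps ls As Hs)).
exists y => //; apply/reachableP; split=> //.
by apply: walk_step wy => //; rewrite leqnn orbT.
Qed.

Lemma reachable_mono m n v u : m <= n -> reachable ord m v u -> reachable ord n v u.
Proof.
by move=> mn /reachableP[uv wu]; apply/reachableP; split=> //; apply: walk_mono wu.
Qed.

Lemma wreachable_mono m n v u : m <= n -> wreachable ord m v u -> wreachable ord n v u.
Proof. by move=> mn /wreachableP wu; apply/wreachableP; apply: walk_mono wu. Qed.

Lemma col_mono m n : m <= n -> col ord m <= col ord n.
Proof.
move=> mn; apply/bigmax_leqP=> v _; apply: leq_trans (leq_bigmax v).
by apply/subset_leq_card/subsetP=> u; rewrite !inE; exact: reachable_mono.
Qed.

Lemma wcol_mono m n : m <= n -> wcol ord m <= wcol ord n.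
Proof.
move=> mn; apply/bigmax_leqP=> v _; apply: leq_trans (leq_bigmax v).
by apply/subset_leq_card/subsetP=> u; rewrite !inE; exact: wreachable_mono.
Qed.

Lemma reach_le_col r v : #|[set u | reachable ord r v u]| <= col ord r.
Proof. exact: (leq_bigmax v). Qed.

Lemma wreach_le_wcol r v : #|[set u | wreachable ord r v u]| <= wcol ord r.
Proof. exact: (leq_bigmax v). Qed.

Lemma col_gt0 r : G -> 0 < col ord r.
Proof.
move=> v; apply: leq_trans (reach_le_col r v); apply/card_gt0P; exists v.
by rewrite inE; apply/reachableP; split=> //; apply: walk0; rewrite eqxx.
Qed.

Lemma wcol_gt0 r : G -> 0 < wcol ord r.
Proof.
move=> v; apply: leq_trans (wreach_le_wcol r v); apply/card_gt0P; exists v.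
by rewrite inE; apply/wreachableP; exact: walk0.
Qed.

End Walks.

Lemma card_bigcup_le (I T : finType) (A : {set I}) (F : I -> {set T}) a m :
  #|A| <= a -> (forall i, i \in A -> #|F i| <= m) ->
  #|\bigcup_(i in A) F i| <= a * m.
Proof.
move=> Aa Fm; apply: (@leq_trans (\sum_(i in A) #|F i|)).
  elim/big_rec2: _ => [|i n B _ IH]; first by rewrite cards0.
  by rewrite (leq_trans (leq_card_setU _ _)) // leq_add2l.
apply: (@leq_trans (\sum_(i in A) m)); first exact: leq_sum.
rewrite sum_nat_const.
by rewrite leq_mul2r Aa orbT.
Qed.

Fixpoint wcol_bound (n c : nat) : nat := if n is n'.+1 then 1 + c * wcol_bound n' c else 1.

(** Iterating [wreachable_step] leaves at most [col ord c] choices at each of [n] steps. This lets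
    the final factor depend on [col] alone. *)
Lemma wcol_le_col (G : sgraph) (ord : G -> nat) n c :
  n <= c -> wcol ord n <= wcol_bound n (col ord c).
Proof.
elim: n => [|n IHn] nc; apply/bigmax_leqP=> v _.
  rewrite /= -(cards1 v); apply/subset_leq_card/subsetP=> u.
  by rewrite !inE => /wreachableP[[|w s] []] //= _ ->.
apply: (@leq_trans #|v |: \bigcup_(y in [set y | reachable ord n.+1 v y])
                            [set u | wreachable ord n y u]|).
  apply/subset_leq_card/subsetP=> u; rewrite !inE => /wreachable_step[->|[y vy yu]].
    by rewrite eqxx.
  by apply/orP; right; apply/bigcupP; exists y; rewrite inE.
apply: leq_trans (leq_card_setU _ _) _; rewrite cards1 leq_add2l.
apply: card_bigcup_le => [|y _].
  by apply: leq_trans (reach_le_col _ _ _) (col_mono _ nc).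
by apply: leq_trans (wreach_le_wcol _ _ _) (IHn (ltnW nc)).
Qed.

(** * Representative subfamilies *)

Section Representatives.
Variables (X U : finType) (A : X -> {set U}).

(** These are the representative families of extremal set theory; for sets [A y] of bounded size,
    [R] can be bounded independently of [F]. *)
Definition represents m (F R : {set X}) : bool :=
  (R \subset F) &&
  [forall Y : {set U}, (#|Y| <= m) ==>
     [exists y in F, [disjoint A y & Y]] ==> [exists y in R, [disjoint A y & Y]]].

Lemma representsP m (F R : {set X}) :
  reflect (R \subset F /\ forall (Y : {set U}) y, #|Y| <= m -> y \in F ->
             [disjoint A y & Y] -> exists2 z, z \in R & [disjoint A z & Y])
    (represents m F R).
Proof.
apply: (iffP andP) => -[RF H]; split=> //.
  move=> Y y Ym yF yY; move/forallP/(_ Y)/implyP/(_ Ym)/implyP: H.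
  by case/(_ _)/exists_inP; [apply/exists_inP; exists y | move=> z; exists z].
apply/forallP=> Y; apply/implyP=> Ym; apply/implyP=> /exists_inP[y yF yY].
by have [z zR zY] := H Y y Ym yF yY; apply/exists_inP; exists z.
Qed.

Fixpoint repset_bound (a m : nat) : nat :=
  if m is m'.+1 then 1 + a * repset_bound a m' else 1.

Definition repset m b (F : {set X}) : {set X} :=
  odflt set0 [pick R | represents m F R && (#|R| <= b)].

(* A set Y meeting A y0 at e leaves only m - 1 elements for the members of F
   avoiding e, so it suffices to recurse on these subfamilies. *)
Lemma repsetP a m (F : {set X}) : (forall y, #|A y| <= a) ->
  let R := repset m (repset_bound a m) F in represents m F R && (#|R| <= repset_bound a m).
Proof.
move=> Aa /=; suff [R rR bR]: exists2 R, represents m F R & #|R| <= repset_bound a m.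
  by rewrite /repset; case: pickP => //= /(_ R); rewrite rR bR.
elim: m F => [|m IHm] F.
  have [->|[y0 y0F]] := set_0Vmem F.
    by exists set0; rewrite ?cards0 //; apply/representsP; split=> // Y y _; rewrite inE.
  exists [set y0]; last by rewrite cards1.
  apply/representsP; split=> [|Y y]; first by rewrite sub1set.
  rewrite leqn0 cards_eq0 => /eqP -> _ _; exists y0; rewrite ?inE //.
  by rewrite disjoint_sym disjoints_subset sub0set.
have [->|[y0 y0F]] := set_0Vmem F.
  by exists set0; rewrite ?cards0 //; apply/representsP; split=> // Y y _; rewrite inE.
pose Fe e := [set y in F | e \notin A y].
pose Re e := repset m (repset_bound a m) (Fe e).
have ReP e : represents m (Fe e) (Re e) && (#|Re e| <= repset_bound a m).
  rewrite /Re /repset; case: pickP => //= no; have [R rR bR] := IHm (Fe e).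
  by have := no R; rewrite rR bR.
exists (y0 |: \bigcup_(e in A y0) Re e); last first.
  apply: leq_trans (leq_card_setU _ _) _; rewrite cards1 leq_add2l.
  by apply: card_bigcup_le => // e _; case/andP: (ReP e).
apply/representsP; split=> [|Y y Ym yF yY].
  rewrite subUset sub1set y0F; apply/bigcupsP=> e _.
  case/andP: (ReP e) => /representsP[sub _] _; apply: subset_trans sub _.
  by apply/subsetP=> y; rewrite inE => /andP[].
have [d|] := boolP [disjoint A y0 & Y]; first by exists y0; rewrite ?setU11.
rewrite -setI_eq0 => /set0Pn[e]; rewrite inE => /andP[ey0 eY].
case/andP: (ReP e) => /representsP[sRe H] _.
have [|||z zR zY] := H (Y :\ e) y.
- by move: Ym; rewrite (cardsD1 e) eY.
- by rewrite inE yF; apply: contraL eY => /(disjointFr yY) ->.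
- by apply: disjointWr yY; exact: subsetDl.
exists z; first by rewrite !inE; apply/orP; right; apply/bigcupP; exists e.
have := subsetP sRe z zR; rewrite inE => /andP[_ ez].
rewrite disjoints_subset; apply/subsetP=> x xz; rewrite inE.
have := disjointFr zY xz; rewrite !inE; case: eqP => [xe|_ /= ->] //.
by rewrite xe (negPf ez) in xz.
Qed.

End Representatives.

(** * Weak reachability with a bottom vertex *)

Section WeakReachability.
Variables (G : sgraph) (ord : G -> nat).

Definition oord (u : option G) : nat := if u is Some v then (ord v).+1 else 0.

(* [None] acts as an extra vertex, below all others and weakly reachable from
   everywhere, so that any two vertices have a common weakly reachable one. *)
Definition wset (r : nat) (u : option G) : {set option G} :=
  [set w | match w, u with
           | None, _ => true
           | Some b, Some a => wreachable ord r a b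
           | Some _, None => false
           end].

Lemma wset_bot r u : None \in wset r u.
Proof. by rewrite inE. Qed.

Lemma wset_refl r u : u \in wset r u.
Proof. by case: u => [u|]; rewrite inE //; apply/wreachableP/walk0. Qed.

Lemma wset_mono m n u : m <= n -> {subset wset m u <= wset n u}.
Proof.
by move=> mn [b|]; rewrite !inE //; case: u => // a; exact: wreachable_mono.
Qed.

Lemma wset_bound_mono m n k : m <= n ->
  (forall u, #|wset n u| <= k) -> forall u, #|wset m u| <= k.
Proof.
move=> mn Wk u; apply: leq_trans (Wk u).
by apply/subset_leq_card/subsetP; exact: wset_mono.
Qed.

Lemma wset_trans r s u v w :
  u \in wset r v -> w \in wset s u -> w \in wset (r + s) v.
Proof.
case: w => [w|]; last by rewrite !wset_bot.
case: u => [u|]; last by rewrite !inE.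
case: v => [v|]; rewrite !inE // => /wreachableP vu /wreachableP uw.
apply/wreachableP; apply: walk_cat (uw); apply: walk_mono vu => // x.
by rewrite !unfold_in; apply: leq_trans; exact: (walk_endl uw).
Qed.

(** Walking back from [u] to [v] and on to [w] never goes below [w], because the way back stays at
    or above [u]. *)
Lemma wset_down r s u v w : u \in wset r v -> w \in wset s v ->
  oord w <= oord u -> w \in wset (r + s) u.
Proof.
case: w => [w|]; last by rewrite !wset_bot.
case: u => [u|] //; case: v => [v|]; rewrite !inE //.
move=> /wreachableP vu /wreachableP vw; rewrite ltnS => wu.
apply/wreachableP; apply: walk_cat (vw); apply: walk_mono (walk_sym vu) => // x.
by rewrite !unfold_in; exact: leq_trans.
Qed.

Lemma wset_adj u v : adj u v ->
  (Some u \in wset 1 (Some v)) || (Some v \in wset 1 (Some u)).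
Proof.
move=> uv; have vu : adj v u by rewrite adj_sym.
rewrite !inE; case/orP: (leq_total (ord u) (ord v)) => le; apply/orP; [left|right];
  by apply/wreachableP; eapply walk_step; [| |apply: walk0]; eauto.
Qed.

Lemma card_wset r u : #|wset r u| <= (wcol ord r).+1.
Proof.
rewrite (cardsD1 None) wset_bot ltnS; case: u => [a|].
  apply: leq_trans (wreach_le_wcol ord r a).
  rewrite -(card_imset [set b | wreachable ord r a b] (@Some_inj _)).
  apply/subset_leq_card/subsetP=> -[b|]; rewrite !inE // => ab.
  by apply/imsetP; exists b; rewrite ?inE.
by rewrite eq_card0 // => -[b|]; rewrite !inE.
Qed.

End WeakReachability.

(** * Addressing elements of bounded sets by position *)

Section Items.
Variable T : finType.

(** The default [b] is meant to lie in [A], so that positions past the end still name an element;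
    below it is always [None]. *)
Definition item (b : T) (A : {set T}) (p : nat) : T := nth b (enum A) p.

Lemma item_in b (A : {set T}) p : b \in A -> item b A p \in A.
Proof.
move=> bA; have [lt|ge] := ltnP p (size (enum A)); last by rewrite /item nth_default.
by rewrite -mem_enum mem_nth.
Qed.

Lemma item_ex b (A : {set T}) N z : #|A| <= N -> z \in A -> exists p : 'I_N, z = item b A p.
Proof.
move=> AN zA; rewrite -mem_enum in zA.
have lt : index z (enum A) < N by rewrite (leq_trans _ AN) // cardE index_mem.
by exists (Ordinal lt); rewrite /item nth_index.
Qed.

(** Once [x] and [y] are located at positions [p] and [q], the same positions locate [x'] and [y'],
    so both equalities become one about positions. *)
Lemma transfer N N' (c c' : 'I_N -> T) (d d' : 'I_N' -> T) x x' y y' :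
  (forall p q, (c p == d q) = (c' p == d' q)) ->
  (exists p, x = c p) -> (exists q, y = d q) ->
  (forall p, (x == c p) = (x' == c' p)) -> (forall q, (y == d q) = (y' == d' q)) ->
  (x == y) = (x' == y').
Proof.
move=> cd [p xc] [q yd] X Y.
have := X p; rewrite {1}xc eqxx => /esym/eqP ->.
have := Y q; rewrite {1}yd eqxx => /esym/eqP ->.
by rewrite xc yd.
Qed.

End Items.

(** * Relations determined by colours and equality patterns *)

Section Determined.
Variables (G : sgraph) (ord : G -> nat) (m : nat).
Local Notation X := (G * 'I_m)%type.
Local Notation U := (option G).
Local Notation W r x := (wset ord r (Some x.1)).
Implicit Types (F : U -> {set U}) (x y : X) (u v w z : U).

Definition hull (F : U -> {set U}) rho (x : X) : {set U} :=
  \bigcup_(u in W rho x) F u.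

Definition similar (C : eqType) (lam : X -> C) (g : X -> {set U}) N n
    (x x' : n.-tuple X) : Prop :=
  (forall i, lam (tnth x i) = lam (tnth x' i)) /\
  forall i j (p q : 'I_N),
    (item None (g (tnth x i)) p == item None (g (tnth x j)) q)
    = (item None (g (tnth x' i)) p == item None (g (tnth x' j)) q).

(** Elements are attached only to vertices weakly reachable from them, which makes shared elements
    traceable in [hull_cap]. The condition at [None] puts the default of [item] into every hull. *)
Definition anchored rho (F : U -> {set U}) N : Prop :=
  [/\ forall u z, z \in F u -> u \in wset ord rho z, None \in F None
    & forall u, #|F u| <= N].

(** Positions run up to [k * N], the size bound of a hull when [k] bounds the weak reachability
    sets. *)
Definition determined rho k N (C : eqType) n (R : n.-tuple X -> bool) : Prop :=
  exists F (lam : X -> C), anchored rho F N /\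
    forall x x' : n.-tuple X, similar lam (hull F rho) (k * N) x x' -> R x = R x'.

Lemma hull_bot F rho x : None \in F None -> None \in hull F rho x.
Proof. by move=> b; apply/bigcupP; exists None; rewrite ?wset_bot. Qed.

Lemma card_hull F rho k N x : (forall v, #|wset ord rho v| <= k) ->
  anchored rho F N -> #|hull F rho x| <= k * N.
Proof. by move=> Wk [_ _ FN]; apply: card_bigcup_le. Qed.

(* [common_hull F rho u] contains everything that the hulls of two vertices share
   when [u] is their largest common weakly (3 rho)-reachable vertex. *)
Definition common_hull (F : U -> {set U}) rho (u : U) : {set U} :=
  \bigcup_(w in wset ord (6 * rho) u) F w.

(** A shared [z] is attached to some [w] seen from [x] and some [w'] seen from [y], both weakly
    reachable from [z]. The smaller of them is weakly reachable from the larger, hence seen from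
    both sides within [3 * rho]; maximality of [u] puts it within [6 * rho] of [u]. *)
Lemma hull_cap F rho N x y u : anchored rho F N -> u \in W (3 * rho) y ->
  (forall w, w \in W (3 * rho) x -> w \in W (3 * rho) y -> oord ord w <= oord ord u) ->
  forall z, z \in hull F rho x -> z \in hull F rho y -> z \in common_hull F rho u.
Proof.
move=> [anc _ _] uy umax z /bigcupP[w wx zw] /bigcupP[w' wy' zw'].
have wz := anc _ _ zw; have wz' := anc _ _ zw'.
have close v : v \in W (3 * rho) x -> v \in W (3 * rho) y -> z \in F v ->
    z \in common_hull F rho u.
  move=> vx vy zv; apply/bigcupP; exists v => //.
  by have := wset_down uy vy (umax v vx vy); rewrite -mulnDl.
case/orP: (leq_total (oord ord w) (oord ord w')) => le.
  apply: (close w) => //; first by apply: wset_mono wx; lia.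
  by have := wset_trans wy' (wset_down wz' wz le); apply: wset_mono; lia.
apply: (close w') => //; last by apply: wset_mono wy'; lia.
by have := wset_trans wx (wset_down wz wz' le); apply: wset_mono; lia.
Qed.

Definition refined (C : finType) N N' (lam : X -> C) (g g' : X -> {set U}) (x : X) :
    (C * {ffun 'I_N * 'I_N' -> bool})%type :=
  (lam x, [ffun pq : 'I_N * 'I_N' => item None (g x) pq.1 == item None (g' x) pq.2]).

(** The refined colour says where each item of [g] sits in [g'], so passing to the larger sets loses
    no information. *)
Lemma refined_similar (C : finType) N N' (lam : X -> C) (g g' : X -> {set U})
    n (x x' : n.-tuple X) :
  (forall x, g x \subset g' x) -> (forall x, None \in g x) ->
  (forall x, #|g' x| <= N') ->
  similar (refined N N' lam g g') g' N' x x' -> similar lam g N x x'.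
Proof.
move=> sub bot size [col pat]; split=> [i|i j p q]; first by case: (col i).
have ex y (r : 'I_N) : exists s : 'I_N', item None (g y) r = item None (g' y) s.
  by apply: item_ex => //; apply: (subsetP (sub y)); exact: item_in.
have eqc l (r : 'I_N) (s : 'I_N') :
    (item None (g (tnth x l)) r == item None (g' (tnth x l)) s) =
    (item None (g (tnth x' l)) r == item None (g' (tnth x' l)) s).
  by have [_ /ffunP/(_ (r, s))] := col l; rewrite !ffunE.
exact: (transfer (pat i j)).
Qed.

Lemma similar_cons (C : eqType) (lam : X -> C) (g : X -> {set U}) N n y y'
    (x x' : n.-tuple X) :
  lam y = lam y' -> similar lam g N x x' ->
  (forall p q : 'I_N, (item None (g y) p == item None (g y) q)
                    = (item None (g y') p == item None (g y') q)) ->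
  (forall j (p q : 'I_N), (item None (g y) p == item None (g (tnth x j)) q)
                    = (item None (g y') p == item None (g (tnth x' j)) q)) ->
  similar lam g N (cons_tuple y x) (cons_tuple y' x').
Proof.
move=> lamy [lamx xx] yy yx; split=> [i|i j p q].
  by case: (unliftP ord0 i) => [j ->|->]; rewrite ?tnthS // !tnth0.
case: (unliftP ord0 i) => [i' ->|->]; case: (unliftP ord0 j) => [j' ->|->];
  rewrite ?tnthS ?tnth0 //.
by rewrite eq_sym yx eq_sym.
Qed.

(** * Bounded sets of witnesses for a quantified variable *)

Section Witnesses.
Variables (rho k N : nat) (C : finType) (F : U -> {set U}) (lam : X -> C).
Hypothesis Wk : forall u, #|wset ord (6 * rho) u| <= k.
Hypothesis ancF : anchored rho F N.
Let B := k * N.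
Let g := hull F rho.

(** The class over [u]: the inner [refined] compares the hull with itself, the outer one locates it
    relative to the common hull. *)
Definition cls u x :=
  refined B B (refined B B lam g g) g (fun=> common_hull F rho u) x.

Lemma g_bot x : None \in g x.
Proof. by case: ancF => _ b _; exact: hull_bot. Qed.

Lemma card_g x : #|g x| <= B.
Proof. by apply: card_hull => //; apply: wset_bound_mono Wk; lia. Qed.

Lemma card_common_hull u : #|common_hull F rho u| <= B.
Proof. by case: ancF => _ _ FN; exact: card_bigcup_le. Qed.

Lemma cls_lam u x y : cls u x = cls u y -> lam x = lam y.
Proof. by case. Qed.

Lemma cls_self u x y (p q : 'I_B) : cls u x = cls u y ->
  (item None (g x) p == item None (g x) q) = (item None (g y) p == item None (g y) q).
Proof. by case=> _ /ffunP/(_ (p, q)); rewrite !ffunE. Qed.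

(** If the hulls meet only inside the common hull, two items agree exactly when they sit at the same
    place in it, and the classes record these places. *)
Lemma cls_pair u x y x' y' (p q : 'I_B) :
  (forall z, z \in g x -> z \in g y -> z \in common_hull F rho u) ->
  (forall z, z \in g x' -> z \in g y' -> z \in common_hull F rho u) ->
  cls u x = cls u x' -> cls u y = cls u y' ->
  (item None (g x) p == item None (g y) q) = (item None (g x') p == item None (g y') q).
Proof.
move=> cap cap' [_ _ /ffunP ex] [_ _ /ffunP ey].
have E x1 y1 : (forall z, z \in g x1 -> z \in g y1 -> z \in common_hull F rho u) ->
    (item None (g x1) p == item None (g y1) q) =
    [exists s : 'I_B, (item None (g x1) p == item None (common_hull F rho u) s)
                   && (item None (g y1) q == item None (common_hull F rho u) s)].
  move=> c; apply/eqP/existsP => [e|[s /andP[/eqP -> /eqP ->]] //].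
  have [|s es] := @item_ex _ None (common_hull F rho u) B (item None (g x1) p) (card_common_hull u).
    by apply: c; [|rewrite e]; apply: item_in; exact: g_bot.
  by exists s; rewrite -e -es eqxx.
rewrite (E _ _ cap) (E _ _ cap'); apply: eq_existsb => s.
by have := ex (p, s); have := ey (q, s); rewrite !ffunE /= => -> ->.
Qed.

(** The hulls of an [n]-tuple have at most [n * B] elements to be avoided, whence the parameter of
    [repset]. *)
Definition witnesses n u : {set X} :=
  \bigcup_(c in [set: C * {ffun 'I_B * 'I_B -> bool} * {ffun 'I_B * 'I_B -> bool}])
     repset (fun y => g y :\: common_hull F rho u) (n * B) (repset_bound B (n * B))
       [set y | (u \in W (3 * rho) y) && (cls u y == c)].

Definition witness_bound n :=
  #|{: C * {ffun 'I_B * 'I_B -> bool} * {ffun 'I_B * 'I_B -> bool}}| * repset_bound B (n * B).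

Lemma rep_spec n u c :
  let A y := g y :\: common_hull F rho u in
  let Fam := [set y | (u \in W (3 * rho) y) && (cls u y == c)] in
  let R := repset A (n * B) (repset_bound B (n * B)) Fam in
  represents A (n * B) Fam R && (#|R| <= repset_bound B (n * B)).
Proof.
apply: repsetP => y; apply: leq_trans (card_g y).
by apply/subset_leq_card/subsetP=> z; rewrite inE => /andP[].
Qed.

Lemma card_witnesses n u : #|witnesses n u| <= witness_bound n.
Proof.
apply: card_bigcup_le => [|c _]; first by rewrite cardsT.
by case/andP: (rep_spec n u c).
Qed.

Lemma witnesses_near n u y : y \in witnesses n u -> u \in W (3 * rho) y.
Proof.
case/bigcupP=> c _; case/andP: (rep_spec n u c) => /representsP[sub _] _.
by move/(subsetP sub); rewrite inE => /andP[].
Qed.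

(** The replacement [y'] has the class of [y] over [u] and, outside the common hull, avoids the
    hulls of the whole tuple; [cls_pair] then compares [y] with [y']. *)
Lemma witness n (x : n.+1.-tuple X) y :
  exists i u y', [/\ u \in W (3 * rho) (tnth x i), y' \in witnesses n.+1 u &
    similar lam g B (cons_tuple y x) (cons_tuple y' x)].
Proof.
pose D u := (u \in W (3 * rho) y) && [exists i, u \in W (3 * rho) (tnth x i)].
have D0 : D None by rewrite /D wset_bot; apply/existsP; exists ord0; rewrite wset_bot.
case: (arg_maxnP (oord ord) D0) => u /andP[uy /existsP[i ux]] umax.
(* [hull_cap] asks that [u] be seen from [y] only, so one [u] serves every entry [j]. *)
have capy j z : z \in g y -> z \in g (tnth x j) -> z \in common_hull F rho u.
  move=> zy zx; apply: (hull_cap (x := tnth x j) ancF uy) zx zy => w wx wy.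
  by apply: umax; rewrite /D wy; apply/existsP; exists j.
case/andP: (rep_spec n.+1 u (cls u y)) => /representsP[sub H] _.
have [|||y' y'R y'Y] := H (\bigcup_(j in [set: 'I_n.+1]) g (tnth x j)) y.
- by apply: card_bigcup_le => [|j _]; rewrite ?cardsT ?card_ord ?card_g.
- by rewrite inE uy eqxx.
- rewrite disjoints_subset; apply/subsetP=> z; rewrite inE => /andP[zK zy].
  by rewrite inE; apply/bigcupP=> -[j _ /(capy j z zy)]; apply/negP.
have := subsetP sub y' y'R; rewrite inE => /andP[uy' /eqP cy'].
exists i, u, y'; split=> //; first by apply/bigcupP; exists (cls u y).
have cap' j z : z \in g y' -> z \in g (tnth x j) -> z \in common_hull F rho u.
  move=> zy zx; apply: contraTT isT => zK.
  have: z \in g y' :\: common_hull F rho u by rewrite inE zK.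
  by move/(disjointFr y'Y)/bigcupP; case; exists j.
apply: similar_cons => [|//|p q|j p q]; first by rewrite (cls_lam cy').
  by rewrite (cls_self _ _ cy').
by apply: (@cls_pair u) => //; [exact: capy | exact: cap'].
Qed.

End Witnesses.

End Determined.

(** * Elimination of an existential quantifier *)

Section Quantifier.
Variables (G : sgraph) (ord : G -> nat) (m : nat).
Local Notation X := (G * 'I_m)%type.
Local Notation U := (option G).
Local Notation W r x := (wset ord r (Some x.1)).
Implicit Types (x y : X) (u v w z : U).

Definition ex_bound k N (C : finType) n : nat := N + witness_bound k N C n * (k * N).

(** The last component describes each candidate witness by its colour and the location of its hull;
    [None] pads short lists. *)
Definition ex_colour k N (C : finType) n : finType :=
  let B := k * N in let B' := k * ex_bound k N C n in
  (C * {ffun 'I_B * 'I_B' -> bool} *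
   {ffun 'I_(k * witness_bound k N C n) ->
      option (C * {ffun 'I_B * 'I_B' -> bool})})%type.

Lemma similar_sym (C : eqType) (lam : X -> C) (g : X -> {set U}) N n
    (x x' : n.-tuple X) : similar lam g N x x' -> similar lam g N x' x.
Proof. by move=> [col pat]; split=> *; rewrite ?col ?pat. Qed.

(** With parts of the witnesses' hulls attached to [u], the new hull of [x] contains the hulls of
    all candidates for [x]. The new colour describes these candidates, so similar tuples have
    matching witnesses. *)
Lemma determined_ex rho k N (C : finType) n (R : n.+2.-tuple X -> bool) :
  (forall u, #|wset ord (7 * rho) u| <= k) -> determined ord rho k N C R ->
  determined ord (7 * rho) k (ex_bound k N C n.+1) (ex_colour k N C n.+1)
    (fun x : n.+1.-tuple X => [exists y, R (cons_tuple y x)]).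
Proof.
move=> Wk7 [F [lam [anc Rdet]]].
have Wk6 u : #|wset ord (6 * rho) u| <= k by apply: wset_bound_mono Wk7 u; lia.
set N' := ex_bound _ _ _ _; set B := k * N; set B' := k * N'.
set M := witness_bound k N C n.+1; pose g : X -> {set U} := hull ord F rho.
pose wit u := witnesses ord rho k N F lam n.+1 u.
(* The restriction on [z] keeps [F'] anchored; [cover] finds the remaining hull elements
   elsewhere. *)
pose F' u := F u :|: \bigcup_(y in wit u) [set z in g y | u \in wset ord (5 * rho) z].
pose g' : X -> {set U} := hull ord F' (7 * rho).
have anc' : anchored ord (7 * rho) F' N'.
  case: anc => ancF botF cardF; split=> [u z||u].
  - rewrite inE => /orP[/ancF|/bigcupP[y _]]; first by apply: wset_mono; lia.
    by rewrite inE => /andP[_]; apply: wset_mono; lia.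
  - by rewrite inE botF.
  - apply: leq_trans (leq_card_setU _ _) (leq_add (cardF u) _).
    apply: card_bigcup_le => [|y _]; first exact: card_witnesses.
    apply: leq_trans (card_g Wk6 (And3 ancF botF cardF) y).
    by apply/subset_leq_card/subsetP=> z; rewrite inE => /andP[].
have cg' x : #|g' x| <= B' by apply: card_hull.
have subg x : g x \subset g' x.
  apply/bigcupsP=> u ux; apply/subsetP=> z zu; apply/bigcupP; exists u.
    by apply: wset_mono ux; lia.
  by rewrite inE zu.
have botg x : None \in g x by exact: (g_bot anc).
have cover x u y : u \in W (3 * rho) x -> y \in wit u -> g y \subset g' x.
  move=> ux yu; have uy := witnesses_near Wk6 anc yu; have [ancF _ _] := anc.
  apply/subsetP=> z zg; have /bigcupP[w wy zw] := zg; have wz := ancF _ _ zw.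
  (* If [u] is at most [w], then [u] is weakly reachable from [z] via [w] within [rho + 4 * rho], so
     [z] is attached to [u]. Otherwise [z] is attached to [w], weakly reachable from [x] via [u]
     within [3 * rho + 4 * rho]. *)
  apply/bigcupP; case: (leqP (oord ord u) (oord ord w)) => le.
    exists u; first by apply: wset_mono ux; lia.
    rewrite inE; apply/orP; right; apply/bigcupP; exists y => //; rewrite inE zg /=.
    by have := wset_trans wz (wset_down wy uy le); apply: wset_mono; lia.
  exists w; last by rewrite inE zw.
  by have := wset_trans ux (wset_down uy wy (ltnW le)); apply: wset_mono; lia.
pose cand x := \bigcup_(u in W (3 * rho) x) wit u.
have ccand x : #|cand x| <= k * M.
  apply: card_bigcup_le => [|u _]; last exact: card_witnesses.
  by apply: wset_bound_mono Wk7 _; lia.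
pose lam' x : ex_colour k N C n.+1 := (refined B B' lam g g' x,
  [ffun c : 'I_(k * M) =>
     omap (refined B B' lam g (fun=> g' x)) (onth (enum (cand x)) c)]).
exists F', lam'; split=> // x x' sim.
suff imp (t t' : n.+1.-tuple X) : similar lam' g' B' t t' ->
    [exists y, R (cons_tuple y t)] -> [exists y, R (cons_tuple y t')].
  by apply/idP/idP; apply: imp => //; exact: similar_sym.
move=> {x x'} {}sim /existsP[y Ry].
have [i [u [y1 [ui y1u sim1]]]] := witness lam Wk6 anc t y.
rewrite (Rdet _ _ sim1) in Ry.
have simg : similar lam g B t t'.
  apply: (refined_similar subg botg cg').
  by case: sim => col pat; split=> // j; rewrite /refined; case: (col j) => -> -> _.
have y1c : y1 \in cand (tnth t i) by apply/bigcupP; exists u.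
have := y1c; rewrite -mem_enum => /onthP[c yc].
have cM : c < k * M.
  by apply: leq_trans (ccand (tnth t i)); rewrite cardE -onthTE yc.
case: sim => col pat.
have [_ _ /ffunP/(_ (Ordinal cM))] := col i; rewrite !ffunE /= yc.
(* Equal colours force the [i]-th entry of [t'] to have a candidate at the same index [c]. *)
case y2c: (onth _ _) => [y2|] //= [] lam12 /ffunP e12.
have eq12 (p : 'I_B) (q : 'I_B') :
    (item None (g y1) p == item None (g' (tnth t i)) q) =
    (item None (g y2) p == item None (g' (tnth t' i)) q).
  by have := e12 (p, q); rewrite !ffunE.
have ex1 (p : 'I_B) : exists q : 'I_B', item None (g y1) p = item None (g' (tnth t i)) q.
  by apply: item_ex => //; apply: (subsetP (cover _ _ _ ui y1u)); exact: item_in.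
apply/existsP; exists y2; rewrite -(Rdet (cons_tuple y1 t)) //.
apply: similar_cons => // [p q|j p q].
  by apply: (transfer (pat i i)).
apply: (transfer (pat i j)) => // [|r].
  by apply: item_ex => //; apply: (subsetP (subg _)); exact: item_in.
by have [_ /ffunP/(_ (q, r))] := col j; rewrite !ffunE.
Qed.

End Quantifier.

(** * Connectives and atomic formulas *)

Section Formulas.
Variables (G : sgraph) (ord : G -> nat) (p m : nat) (P : 'I_p -> {set G}).
Local Notation X := (G * 'I_m)%type.
Local Notation U := (option G).
Local Notation W r x := (wset ord r (Some x.1)).
Implicit Types (x y : X) (u v w z : U).


Lemma determined_not rho k N (C : eqType) n (R : n.-tuple X -> bool) :
  determined ord rho k N C R -> determined ord rho k N C (fun e => ~~ R e).
Proof.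
by move=> [F [lam [anc det]]]; exists F, lam; split=> // x x' /det ->.
Qed.

Definition and_colour k N1 N2 (C1 C2 : finType) : finType :=
  ((C1 * {ffun 'I_(k * N1) * 'I_(k * (N1 + N2)) -> bool}) *
   (C2 * {ffun 'I_(k * N2) * 'I_(k * (N1 + N2)) -> bool}))%type.

(** The attachments are united, and [refined] locates each old hull inside the joint one. *)
Lemma determined_and rho1 rho2 k N1 N2 (C1 C2 : finType) n (R1 R2 : n.-tuple X -> bool) :
  (forall u, #|wset ord (rho1 + rho2) u| <= k) ->
  determined ord rho1 k N1 C1 R1 -> determined ord rho2 k N2 C2 R2 ->
  determined ord (rho1 + rho2) k (N1 + N2) (and_colour k N1 N2 C1 C2)
    (fun e => R1 e && R2 e).
Proof.
move=> Wk [F1 [lam1 [anc1 det1]]] [F2 [lam2 [anc2 det2]]].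
have [a1 b1 c1] := anc1; have [a2 b2 c2] := anc2.
pose F u := F1 u :|: F2 u; pose g : X -> {set U} := hull ord F (rho1 + rho2).
have anc : anchored ord (rho1 + rho2) F (N1 + N2).
  split=> [u z||u]; last 1 first.
    by apply: leq_trans (leq_card_setU _ _) (leq_add (c1 u) (c2 u)).
    by case/setUP=> [/a1|/a2]; apply: wset_mono; lia.
  by rewrite inE b1.
have cg x : #|g x| <= k * (N1 + N2) by apply: card_hull.
have sub1 x : hull ord F1 rho1 x \subset g x.
  apply/bigcupsP=> u ux; apply/subsetP=> z zu; apply/bigcupP; exists u.
    by apply: wset_mono ux; lia.
  by rewrite inE zu.
have sub2 x : hull ord F2 rho2 x \subset g x.
  apply/bigcupsP=> u ux; apply/subsetP=> z zu; apply/bigcupP; exists u.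
    by apply: wset_mono ux; lia.
  by rewrite inE zu orbT.
exists F, (fun x => (refined (k * N1) (k * (N1 + N2)) lam1 (hull ord F1 rho1) g x,
                     refined (k * N2) (k * (N1 + N2)) lam2 (hull ord F2 rho2) g x)).
split=> // x x' [col pat]; congr (_ && _).
  apply/det1/(refined_similar sub1 _ cg); first by move=> y; exact: hull_bot.
  by split=> // i; rewrite /refined; case: (col i) => -> ->.
apply/det2/(refined_similar sub2 _ cg); first by move=> y; exact: hull_bot.
by split=> // i; rewrite /refined; case: (col i) => _ _ -> ->.
Qed.

Section Atoms.
Variable k : nat.
Hypothesis Wk : forall u, #|wset ord 1 u| <= k.
Local Notation B := (k * 1).

(** For atoms each vertex is attached to itself alone, so hulls are weak 1-reachability sets; [self]
    and [nbr] mark the positions of the vertex and of its neighbours there. *)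
Definition self x (q : 'I_B) := item None (W 1 x) q == Some x.1.
Definition nbr x (q : 'I_B) := if item None (W 1 x) q is Some w then adj x.1 w else false.

Definition atom_colour : finType :=
  ('I_m * {ffun 'I_p -> bool} * {ffun 'I_B -> bool} * {ffun 'I_B -> bool})%type.

Definition atom_lam x : atom_colour :=
  (x.2, [ffun a => x.1 \in P a], [ffun q => self x q], [ffun q => nbr x q]).

Lemma anchored1 : anchored ord 1 (fun u => [set u]) 1.
Proof.
split=> [u z||u]; last by rewrite cards1.
  by move/set1P=> ->; exact: wset_refl.
by rewrite inE.
Qed.

Lemma hull1 x : hull ord (fun u => [set u]) 1 x = W 1 x.
Proof.
apply/setP=> z; apply/bigcupP/idP => [[u ux /set1P -> //]|zx].
by exists z; rewrite ?set11.
Qed.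

Lemma item_wset x z : z \in W 1 x -> exists q : 'I_B, z = item None (W 1 x) q.
Proof. by apply: item_ex; rewrite muln1. Qed.

Lemma eq_vertexE x y : (x.1 == y.1) =
  [exists q, exists r, [&& self x q, self y r & item None (W 1 x) q == item None (W 1 y) r]].
Proof.
apply/eqP/idP => [xy|/existsP[q /existsP[r /and3P[/eqP -> /eqP -> /eqP[]]]] //].
have [q xq] := item_wset (wset_refl ord 1 (Some x.1)).
have [r yr] := item_wset (wset_refl ord 1 (Some y.1)).
by apply/existsP; exists q; apply/existsP; exists r; rewrite /self -xq -yr xy !eqxx.
Qed.

Definition adj_down x y :=
  [exists q, exists r, [&& nbr x q, self y r & item None (W 1 x) q == item None (W 1 y) r]].

(** An edge is visible from its larger end, from which the smaller one is weakly 1-reachable. *)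
Lemma adjE x y : adj x.1 y.1 = adj_down x y || adj_down y x.
Proof.
have down x1 y1 : adj_down x1 y1 -> adj x1.1 y1.1.
  case/existsP=> q /existsP[r /and3P[h /eqP yr /eqP xy]].
  by move: h; rewrite /nbr xy yr.
have up x1 y1 : adj x1.1 y1.1 -> Some y1.1 \in W 1 x1 -> adj_down x1 y1.
  move=> xy /item_wset[q eq]; have [r er] := item_wset (wset_refl ord 1 (Some y1.1)).
  apply/existsP; exists q; apply/existsP; exists r.
  by rewrite /nbr /self -eq -er xy !eqxx.
apply/idP/orP => [xy|[/down //|/down]]; last by rewrite adj_sym.
by case/orP: (wset_adj ord xy) => h; [right|left]; apply: up => //; rewrite adj_sym.
Qed.

Lemma atom_determined n (R : n.-tuple X -> bool) :
  (forall x x' : n.-tuple X, similar atom_lam (fun x => W 1 x) B x x' -> R x = R x') ->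
  determined ord 1 k 1 atom_colour R.
Proof.
move=> RR; exists (fun u => [set u]), atom_lam; split; first exact: anchored1.
by move=> x x' [col pat]; apply: RR; split=> // i j q r; have := pat i j q r; rewrite !hull1.
Qed.

Section Similar.
Variables (n : nat) (e e' : n.-tuple X) (i j : 'I_n).
Hypothesis sim : similar atom_lam (fun x => W 1 x) B e e'.

Lemma similar_layer : (tnth e i).2 = (tnth e' i).2.
Proof. by case: sim => /(_ i) []. Qed.

Lemma similar_param a : ((tnth e i).1 \in P a) = ((tnth e' i).1 \in P a).
Proof. by case: sim => /(_ i) [_ /ffunP/(_ a)]; rewrite !ffunE. Qed.

Lemma similar_self q : self (tnth e i) q = self (tnth e' i) q.
Proof. by case: sim => /(_ i) [_ _ /ffunP/(_ q)]; rewrite !ffunE. Qed.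

Lemma similar_nbr q : nbr (tnth e i) q = nbr (tnth e' i) q.
Proof. by case: sim => /(_ i) [_ _ _ /ffunP/(_ q)]; rewrite !ffunE. Qed.

End Similar.

Lemma similar_vertex n (e e' : n.-tuple X) i j :
  similar atom_lam (fun x => W 1 x) B e e' ->
  ((tnth e i).1 == (tnth e j).1) = ((tnth e' i).1 == (tnth e' j).1).
Proof.
move=> sim; rewrite !eq_vertexE; apply: eq_existsb => q; apply: eq_existsb => r.
by rewrite !(similar_self _ sim); case: sim => _ ->.
Qed.

Lemma similar_adj n (e e' : n.-tuple X) i j :
  similar atom_lam (fun x => W 1 x) B e e' ->
  adj (tnth e i).1 (tnth e j).1 = adj (tnth e' i).1 (tnth e' j).1.
Proof.
move=> sim; rewrite !adjE; congr (_ || _); apply: eq_existsb => q;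
  apply: eq_existsb => r;
  by rewrite (similar_self _ sim) (similar_nbr _ sim); case: sim => _ ->.
Qed.

End Atoms.

End Formulas.

(** The radius depends on the formula alone, [N] and [C] also on [k], never on the graph. Sigma
    types let [N] and [C] enter the definition of a function of the colouring number. By [0 < n],
    each quantifier has a nonempty tuple in scope, as [determined_ex] requires. *)
Theorem formula_determined p m n (f : formula p m n) : 0 < n ->
  {rho : nat & forall k, {N : nat & {C : finType |
     forall (G : sgraph) (ord : G -> nat) (P : 'I_p -> {set G}),
       (forall u, #|wset ord rho u| <= k) ->
       determined ord rho k N C (@sat _ _ (copy_structure m P) _ f)}}}.
Proof.
elim: n / f => n.
- move=> i j _; exists 1 => k; exists 1, (atom_colour p m k) => G ord P Wk.
  apply: (atom_determined (P := P)) => e e' sim /=.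
  by rewrite -!pair_eqE /pair_eq /= (similar_vertex Wk _ _ sim) !(similar_layer _ sim).
- move=> i j _; exists 1 => k; exists 1, (atom_colour p m k) => G ord P Wk.
  apply: (atom_determined (P := P)) => e e' sim /=.
  by rewrite (similar_adj Wk _ _ sim) !(similar_layer _ sim).
- move=> i j _; exists 1 => k; exists 1, (atom_colour p m k) => G ord P Wk.
  apply: (atom_determined (P := P)) => e e' sim /=.
  by rewrite (similar_vertex Wk _ _ sim).
- move=> a i _; exists 1 => k; exists 1, (atom_colour p m k) => G ord P Wk.
  apply: (atom_determined (P := P)) => e e' sim /=.
  by rewrite (similar_param _ sim).
- move=> a i _; exists 1 => k; exists 1, (atom_colour p m k) => G ord P Wk.
  apply: (atom_determined (P := P)) => e e' sim /=.
  by rewrite (similar_layer _ sim).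
- move=> g IHg n0; have [rho H] := IHg n0; exists rho => k.
  have [N [C HC]] := H k; exists N, C => G ord P Wk.
  exact: determined_not (HC _ _ P Wk).
- move=> g1 IH1 g2 IH2 n0; have [rho1 H1] := IH1 n0; have [rho2 H2] := IH2 n0.
  exists (rho1 + rho2) => k; have [N1 [C1 HC1]] := H1 k; have [N2 [C2 HC2]] := H2 k.
  exists (N1 + N2), (and_colour k N1 N2 C1 C2) => G ord P Wk.
  apply: determined_and => //.
    by apply: HC1; apply: wset_bound_mono Wk; exact: leq_addr.
  by apply: HC2; apply: wset_bound_mono Wk; exact: leq_addl.
case: n => // n g IHg _; have [rho H] := IHg isT; exists (7 * rho) => k.
have [N [C HC]] := H k; exists (ex_bound k N C n.+1), (ex_colour k N C n.+1).
move=> G ord P Wk; apply: determined_ex => //; apply: HC; apply: wset_bound_mono Wk; lia.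
Qed.

(** * Construction of the lacon-decomposition *)

Lemma lex_le n a b i j : i < n -> j < n -> a * n + i <= b * n + j -> a <= b.
Proof. by move=> *; rewrite leqNgt; apply/negP => *; nia. Qed.

Lemma bound_le S w k q a : 0 < w -> 0 < k -> S <= 2 * k * w -> a <= S * q ->
  1 + a <= (1 + 2 * k * q) * w.
Proof.
move=> w0 k0 Sw aS; rewrite mulnDl mul1n leq_add //.
by apply: leq_trans aS _; rewrite mulnAC leq_mul2r Sw orbT.
Qed.

Section LaconOf.
Variables (G : sgraph) (ord : G -> nat) (T Cl : finType) (base : T -> G) (R : nat).
Variables (cl : option G -> T -> Cl) (E : rel T).
Local Notation U := (option G).
Local Notation W t := (wset ord R (Some (base t))).
Hypothesis ord_inj : injective ord.
Hypothesis E_sym : symmetric E.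

Definition top u t t' :=
  [&& u \in W t, u \in W t'
    & [forall w, (w \in W t) && (w \in W t') ==> (oord ord w <= oord ord u)]].

Hypothesis E_cl : forall u t1 t2 t1' t2', top u t1 t2 -> top u t1' t2' ->
  cl u t1 = cl u t1' -> cl u t2 = cl u t2' -> E t1 t2 = E t1' t2'.

Definition hid : finType := (U * Cl * Cl)%type.
Implicit Types (h : hid) (t : T) (u w : U).

Definition diag h := h.1.2 == h.2.

(** Lexicographic in base vertex, diagonal bit and rank. Two targets of the same class [i] over [u]
    are both adjacent to every [(u, i, j)]; the bit puts [(u, i, i)] on top of these. *)
Definition key h := (oord ord h.1.1 * 2 + diag h) * #|{: hid}| + enum_rank h.

Lemma oord_inj : injective (oord ord).
Proof. by move=> [a|] [b|] //= [/ord_inj ->]. Qed.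

Lemma key_le h h' : key h <= key h' ->
  oord ord h.1.1 * 2 + diag h <= oord ord h'.1.1 * 2 + diag h'.
Proof. by apply: lex_le; exact: ltn_ord. Qed.

Lemma key_oord h h' : key h <= key h' -> oord ord h.1.1 <= oord ord h'.1.1.
Proof. by move/key_le; case: (diag h); case: (diag h') => /=; lia. Qed.

Lemma key_inj : injective key.
Proof.
move=> h h' e; have := key_le (eq_leq e); have := key_le (eq_leq (esym e)).
move=> le ge; have le2 := anti_leq (introT andP (conj ge le)).
apply/enum_rank_inj/val_inj/eqP; move/eqP: e.
by rewrite /key le2 eqn_add2l.
Qed.

Definition lacon_ord (x : T + hid) : nat :=
  match x with
  | inl t => (\max_(h : hid) key h).+1 + enum_rank t
  | inr h => key h
  end.

Lemma lacon_ord_ht h t : lacon_ord (inr h) < lacon_ord (inl t).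
Proof. by rewrite /= addSn ltnS; apply: leq_trans (leq_bigmax h) (leq_addr _ _). Qed.

Lemma lacon_ord_inj : injective lacon_ord.
Proof.
move=> [t|h] [t'|h'] e.
- by congr inl; apply/enum_rank_inj/val_inj/eqP; move/eqP: e; rewrite /= eqn_add2l.
- by have := lacon_ord_ht h' t; rewrite e ltnn.
- by have := lacon_ord_ht h t'; rewrite e ltnn.
- by congr inr; exact: key_inj.
Qed.

Definition hid_adj t h :=
  (h.1.1 \in W t) && ((cl h.1.1 t == h.1.2) || (cl h.1.1 t == h.2)).

Definition hid_label h := [exists t1, exists t2,
  [&& top h.1.1 t1 t2, cl h.1.1 t1 == h.1.2, cl h.1.1 t2 == h.2 & E t1 t2]].

(** The bottom vertex is weakly reachable from every target, so a triple over it can be shared. *)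
Lemma hid_common t t' : exists h, hid_adj t h && hid_adj t' h.
Proof.
by exists (None, cl None t, cl None t'); rewrite /hid_adj !wset_bot !eqxx ?orbT.
Qed.

Definition lacon_of : lacon T :=
  Lacon hid_label lacon_ord_inj lacon_ord_ht hid_common.

Lemma top_sym u t t' : top u t t' = top u t' t.
Proof.
rewrite /top andbCA; congr [&& _, _ & _].
by apply: eq_forallb => w; rewrite andbC.
Qed.

Lemma hid_labelE u t t' : top u t t' -> hid_label (u, cl u t, cl u t') = E t t'.
Proof.
move=> top_u; apply/existsP/idP => [[t1 /existsP[t2 /and4P[top12 /eqP c1 /eqP c2]]]|Ett'].
  by rewrite (E_cl top12 top_u c1 c2).
by exists t; apply/existsP; exists t'; rewrite top_u !eqxx.
Qed.

Lemma hid_label_sym u i j : hid_label (u, i, j) = hid_label (u, j, i).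
Proof.
suff imp i1 j1 : hid_label (u, i1, j1) -> hid_label (u, j1, i1).
  by apply/idP/idP; exact: imp.
case/existsP=> t1 /existsP[t2 /and4P[/= top12 c1 c2 E12]].
by apply/existsP; exists t2; apply/existsP; exists t1; rewrite /= top_sym top12 c1 c2 E_sym.
Qed.

Lemma top_exists t t' : exists u, top u t t'.
Proof.
pose D u := (u \in W t) && (u \in W t').
have D0 : D None by rewrite /D !wset_bot.
case: (arg_maxnP (oord ord) D0) => u /andP[ut ut'] umax; exists u.
by rewrite /top ut ut'; apply/forallP=> w; apply/implyP; exact: umax.
Qed.

(** Comparison with [(u, cl u t, cl u t')], for the largest common [u], shows that the dominant
    triple lies over [u] as well. *)
Lemma dominant_label t t' h :
  dominant (L := lacon_of) t t' h -> hid_label h = E t t'.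
Proof.
have [u top_u] := top_exists t t'.
case: h => [[v i] j] [/andP[/andP[/= vt it] /andP[/= vt' it']] hmax].
case/and3P: (top_u) => ut ut' /forallP umax.
have adjs c c' : (c == cl u t) || (c' == cl u t) -> (c == cl u t') || (c' == cl u t') ->
    key (u, c, c') <= key (v, i, j).
  move=> ct ct'; apply: hmax; rewrite /= /hid_adj /= ut ut' /=.
  by rewrite eq_sym ![cl u _ == c']eq_sym [cl u t' == c]eq_sym ct ct'.
have uv : v = u.
  apply/oord_inj/eqP; rewrite eqn_leq (implyP (umax v)) ?vt ?vt' //=.
  by apply: (@key_oord (u, cl u t, cl u t') (v, i, j)); apply: adjs; rewrite eqxx ?orbT.
subst v; rewrite -(hid_labelE top_u).
(* For equal classes the diagonal bit forces [i = j]; distinct ones must be [i] and [j] in some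
   order. *)
have [e|ne] := eqVneq (cl u t) (cl u t').
  have := key_le (adjs (cl u t) (cl u t) _ _); rewrite /diag /= -e !eqxx => /(_ isT isT).
  rewrite leq_add2l; case: (i =P j) => // ij _; move: it; rewrite -ij orbb => /eqP ->.
  by [].
move: it it' ne => /orP[] /eqP -> /orP[] /eqP ->; rewrite ?eqxx // => _.
by rewrite hid_label_sym.
Qed.

Lemma lacon_of_correct t t' :
  E t t' <-> exists2 h, dominant (L := lacon_of) t t' h & label h.
Proof.
split=> [Ett'|[h dom lab]]; last by rewrite -(dominant_label dom).
have [h0 h0P] := hid_common t t'.
case: (arg_maxnP (P := fun h => hid_adj t h && hid_adj t' h) key h0P) => h hP hmax.
have dom : dominant (L := lacon_of) t t' h by split.
by exists h => //; change (is_true (hid_label h)); rewrite (dominant_label dom).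
Qed.

(** * Colouring numbers of the decomposition *)

Section Bounds.
Variable k : nat.
Hypothesis Wk : forall u, #|wset ord R u| <= k.
Local Notation L := (lacon_graph lacon_of).
Implicit Types x y z : L.

Definition proj x : U := match x with inl t => Some (base t) | inr h => h.1.1 end.

Definition over (S : {set U}) : {set L} :=
  [set x | match x with inr h => h.1.1 \in S | inl _ => false end].

Lemma card_over S : #|over S| <= #|S| * #|{: Cl * Cl}|.
Proof.
rewrite -[#|{: Cl * Cl}|]cardsT -cardsX.
pose f (c : U * (Cl * Cl)) : L := inr (c.1, c.2.1, c.2.2).
apply: (@leq_trans #|f @: setX S setT|); last exact: leq_imset_card.
apply/subset_leq_card/subsetP=> -[t|[[u i] j]]; rewrite inE //= => uS.
by apply/imsetP; exists (u, (i, j)); rewrite ?inE ?uS.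
Qed.

Lemma lacon_edge t h : adj (s := L) (inl t) (inr h) -> h.1.1 \in W t.
Proof. by case/andP. Qed.

(** Each edge costs radius [R]: a step from target to hidden vertex composes by [wset_trans], a step
    from hidden vertex to target by [wset_down], since the base of [h] is lowest among those of the
    hidden vertices met. *)
Lemma weak_walk_proj n x h :
  walk (fun w : L => lacon_ord (inr h) <= lacon_ord w) n x (inr h) ->
  h.1.1 \in wset ord (R * n) (proj x).
Proof.
case=> s; elim: s x n => [|w s IHs] x n [/= ps ls As Hs].
  by rewrite ls; exact: wset_refl.
case: n Hs => // n Hs; case/andP: ps => xw ps; case/andP: As => hx As.
have := IHs w n (And4 ps ls As Hs); rewrite mulnS.
case: x w xw hx {ps ls As} => [t|h1] [t'|h2] // xw hx.
  exact: wset_trans (lacon_edge xw).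
by move=> h'; apply: wset_down (lacon_edge xw) h' _; exact: key_oord.
Qed.

Lemma weak_walk_target n x t :
  walk (fun w : L => lacon_ord (inl t) <= lacon_ord w) n x (inl t) -> x = inl t.
Proof.
have tgt (w : L) : lacon_ord (inl t) <= lacon_ord w -> exists t', w = inl t'.
  by case: w => [t' _|h]; [exists t' | rewrite leqNgt lacon_ord_ht].
case=> -[|w s] [] //= ps _ /and3P[tx tw _] _.
have [t1 x1] := tgt _ tx; have [t2 w2] := tgt _ tw.
by move: ps; rewrite x1 w2.
Qed.

Lemma k_gt0 : 0 < k.
Proof. by apply: leq_trans (Wk None); apply/card_gt0P; exists None; exact: wset_bot. Qed.

Lemma wcol_lacon (v0 : G) r : wcol (G := L) lacon_ord r <=
  (1 + 2 * k * #|{: Cl * Cl}|) * wcol ord (R * r).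
Proof.
apply/bigmax_leqP=> x _.
apply: (@leq_trans #|x |: over (wset ord (R * r) (proj x))|).
  apply/subset_leq_card/subsetP=> -[t|h]; rewrite in_set => /wreachableP.
    by move/weak_walk_target ->; rewrite setU11.
  by move/weak_walk_proj=> hx; apply/setUP; right; rewrite in_set.
apply: leq_trans (leq_card_setU _ _) _; rewrite cards1.
have w0 := wcol_gt0 ord (R * r) v0; have k0 := k_gt0.
apply: bound_le (card_over _) => //.
by have := card_wset ord (R * r) (proj x); nia.
Qed.

(** The first step from a target leads to a hidden vertex, which lies below it and must therefore be
    the end [y]. *)
Lemma reach_proj_target t r y :
  reachable (G := L) lacon_ord r (inl t) y -> y \in (inl t : L) |: over (W t).
Proof.
case/reachableP=> _ [[|w s] [/= ps ls As _]]; first by rewrite -ls setU11.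
case/andP: ps => tw _; case/and3P: As => _ + _.
case: w tw {ls} => [//|h] tw; rewrite leqNgt lacon_ord_ht orbF => /eqP <-.
by apply/setUP; right; rewrite inE; exact: lacon_edge.
Qed.

Definition reach_cover (u : U) r : {set U} :=
  if u is Some b then
    \bigcup_(y in [set y : G | reachable ord (R * r) b y]) wset ord R (Some y)
  else [set None].

(** The walk is followed in [G] above [b], the base of [g]. When its last edge drops below [g], the
    corresponding walk to the base of [h] is cut at its first vertex [y] not above [b]: [y] is
    reachable from [b], and the base of [h] is weakly reachable from [y]. *)
Lemma reach_proj_hidden g h r : reachable (G := L) lacon_ord r (inr g) (inr h) ->
  h.1.1 \in reach_cover g.1.1 r.
Proof.
case/reachableP=> hg wgh; have := key_oord hg.
case gb: g.1.1 => [b|] /=; last first.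
  by case: (h.1.1) => // _; rewrite set11.
case ha: h.1.1 => [a|] /=; last first.
  move=> _; apply/bigcupP; exists b; last exact: wset_bot.
  by rewrite inE; apply/reachableP; split=> //; apply: walk0; rewrite eqxx.
rewrite ltnS => ab.
suff main s z n : lacon_ord (inr g) <= lacon_ord z ->
    [/\ path adj z s, last z s = inr h,
        all (fun w : L => (w == inr h) || (lacon_ord (inr g) <= lacon_ord w)) (z :: s)
      & size s <= n] ->
    exists c (y : G), [/\ proj z = Some c,
      walk (fun w : G => (w == y) || (ord b <= ord w)) (R * n) c y,
      ord y <= ord b & Some a \in wset ord R (Some y)].
  have [s ws] := wgh; have [c [y [/= gc wy yb ya]]] := main _ _ _ (leqnn _) ws.
  apply/bigcupP; exists y => //; rewrite inE; apply/reachableP; split=> //.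
  by move: gc wy; rewrite gb => -[<-].
have gle (e : hid) : key g <= key e -> exists2 c, e.1.1 = Some c & ord b <= ord c.
  by move/key_oord; rewrite gb; case: (e.1.1) => // c; exists c.
elim: s z n => [|w s IHs] z n gz [/= ps ls As Hs].
  move: gz; rewrite ls => gz; exists a, a; split=> //; last exact: wset_refl.
  by apply: walk0; rewrite eqxx.
case: n Hs => // n Hs; case/andP: ps => zw ps; case/andP: As => _ As.
have [gw|wg] := leqP (lacon_ord (inr g)) (lacon_ord w).
  have [c [y [wc wy yb ya]]] := IHs w n gw (And4 ps ls As Hs).
  (* Both ends of the edge are at or above [g], so it projects to a walk that stays at or above
     [b]. *)
  suff [d zd dc] : exists2 d, proj z = Some d & walk (fun w : G => ord b <= ord w) R d c.
    exists d, y; split=> //; rewrite mulnS; apply: walk_cat wy.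
    by apply: walk_mono dc => // x bx; rewrite unfold_in; apply/orP; right.
  case: z w zw gz gw wc {ps ls As} => [t|e] [t'|e'] // zw gz gw wc.
    exists (base t) => //; move: (lacon_edge zw) wc => /= zw' wc; move: zw'; rewrite wc.
    rewrite inE => /wreachableP; apply: walk_mono => // x; rewrite !unfold_in.
    by have [c' + bc] := gle _ gw; rewrite wc => -[cc]; rewrite cc; exact: leq_trans.
  have [d ed bd] := gle _ gz; exists d => //; case: wc => <-.
  have := lacon_edge zw; rewrite ed inE => /wreachableP /walk_sym.
  by apply: walk_mono => // x; rewrite !unfold_in; exact: leq_trans.
have /eqP wh : w == inr h by move: As => /= /andP[]; rewrite leqNgt wg orbF.
move: zw; rewrite wh {gz IHs}; case: z => [t|e] // zw; exists (base t).
have := lacon_edge zw; rewrite ha inE => /wreachableP /(walk_split ab)[y [wy yb ya]].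
exists y; split=> //; last by rewrite inE.
by apply: walk_mono wy => //; rewrite mulnS leq_addr.
Qed.

Lemma col_lacon (v0 : G) r : col (G := L) lacon_ord r <=
  (1 + 2 * k * #|{: Cl * Cl}|) * col ord (R * r).
Proof.
have c0 := col_gt0 ord (R * r) v0; have k0 := k_gt0.
apply/bigmax_leqP=> -[t|g] _.
  apply: (@leq_trans #|(inl t : L) |: over (W t)|).
    by apply/subset_leq_card/subsetP=> y; rewrite inE => /reach_proj_target.
  apply: leq_trans (leq_card_setU _ _) _; rewrite cards1.
  by apply: bound_le (card_over _) => //; have := Wk (Some (base t)); nia.
apply: (@leq_trans #|over (reach_cover g.1.1 r)|).
  apply/subset_leq_card/subsetP=> -[t|h]; rewrite !in_set; last exact: reach_proj_hidden.
  by case/andP; rewrite leqNgt lacon_ord_ht.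
apply: leq_trans (leq_addl 1 _) (bound_le c0 k0 _ (card_over _)).
suff: #|reach_cover g.1.1 r| <= col ord (R * r) * k by nia.
case: (g.1.1) => [b|] /=; last by rewrite cards1; nia.
by apply: card_bigcup_le => [|y _]; first exact: reach_le_col.
Qed.

End Bounds.
End LaconOf.

(** * Application to transductions *)

Definition cls_type B (C : finType) : finType :=
  (C * {ffun 'I_B * 'I_B -> bool} * {ffun 'I_B * 'I_B -> bool})%type.

(** Over the largest common vertex the hulls meet only in the common hull, so the classes fix the
    equality pattern of the pair. This supplies [E_cl]. *)
Lemma top_pair (G : sgraph) (ord : G -> nat) m rho k N (C : finType)
    (R : 2.-tuple (G * 'I_m)%type -> bool) F lam :
  (forall u, #|wset ord (6 * rho) u| <= k) -> anchored ord rho F N ->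
  (forall x x' : 2.-tuple (G * 'I_m)%type,
     similar (C := C) lam (hull ord F rho) (k * N) x x' -> R x = R x') ->
  forall u x y x' y',
    top ord fst (3 * rho) u x y -> top ord fst (3 * rho) u x' y' ->
    cls ord rho k N F lam u x = cls ord rho k N F lam u x' ->
    cls ord rho k N F lam u y = cls ord rho k N F lam u y' ->
    R [tuple x; y] = R [tuple x'; y'].
Proof.
move=> Wk anc Rdet u x y x' y' txy txy' ex ey; apply: Rdet.
have cap (x1 y1 : G * 'I_m) z : top ord fst (3 * rho) u x1 y1 ->
    z \in hull ord F rho x1 -> z \in hull ord F rho y1 -> z \in common_hull ord F rho u.
  case/and3P=> _ uy /forallP umax; apply: (hull_cap anc uy) => w wx wy.
  by apply: (implyP (umax w)); rewrite wx wy.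
have xy p q := cls_pair Wk anc p q (fun z => cap x y z txy) (fun z => cap x' y' z txy') ex ey.
split=> [i|i j p q].
  case: (unliftP ord0 i) => [i' ->|->]; rewrite ?tnthS ?tnth0 ?(cls_lam ex) //.
  by rewrite (ord1 i') !tnth0 (cls_lam ey).
by case: (unliftP ord0 i) => [i' ->|->]; case: (unliftP ord0 j) => [j' ->|->];
  rewrite ?tnthS ?tnth0 ?ord1 ?tnth0 ?(cls_self _ _ ex) ?(cls_self _ _ ey) //;
  rewrite 1?eq_sym ?xy // eq_sym.
Qed.

Theorem theorem18 (tau : transduction) :
  exists (c : nat) (f : nat -> nat),
    forall (G : sgraph) (sigma : G -> nat) (D : sgraph),
      injective sigma -> transduces tau G D ->
      exists L : lacon D,
        lacon_decomposition_of L /\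
        forall r : nat,
          col (G := lacon_graph L) (lord L) r
            <= f (col sigma c) * col sigma (c * r) /\
          wcol (G := lacon_graph L) (lord L) r
            <= f (col sigma c) * wcol sigma (c * r).
Proof.
have [rho H] := formula_determined (phi tau) isT.
(* Common hulls have radius [6 * rho], while the decomposition uses only [3 * rho]. The successor
   counts the bottom vertex. *)
pose c := 6 * rho; pose k x := (wcol_bound c x).+1.
pose Cl x := let: existT N (exist C _) := H (k x) in cls_type (k x * N) C.
exists c, (fun x => 1 + 2 * k x * #|{: Cl x * Cl x}|) => G sigma D sigma_inj [P].
rewrite /basic_transduction; case: ifP => // _ [eD]; subst D.
set D := SGraph _ _.
(* A vertex of [G] makes the colouring numbers positive, as the bounds require. Without one, [D] and
   the decomposition are empty. *)
case: (pickP G) => [v0 _|G0]; last first.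
  have D0 (t : D) : False by have := G0 (val t).1.
  have inj0 : injective (fun _ : D + void => 0) by case=> [t|[]]; case: (D0 t).
  have [ht0 com0] : (forall (h : void) (t : D), 0 < 0) /\
      (forall t t' : D, exists h : void, true && true) by split=> [[]|t]; case: (D0 t).
  exists (Lacon (biadj := fun _ _ => true) (fun _ => true) inj0 ht0 com0).
  split=> [t|r]; first by case: (D0 t).
  by split; apply/bigmax_leqP=> -[t|[]]; case: (D0 t).
set kk := k (col sigma c).
have Wk u : #|wset sigma c u| <= kk.
  by apply: leq_trans (card_wset _ _ _) _; rewrite ltnS; exact: wcol_le_col.
rewrite /Cl -/kk; case: (H kk) => N [C HC].
have [|F [lam [anc det]]] := HC G sigma P; first by apply: wset_bound_mono Wk; lia.
pose base (t : D) := (val t).1; pose cl u (t : D) := cls sigma rho kk N F lam u (val t).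
pose R (e : 2.-tuple (G * 'I_(ncopy tau))%type) := @sat _ _ (copy_structure _ P) _ (phi tau) e.
pose E (t t' : D) := R [tuple val t; val t'] || R [tuple val t'; val t].
have E_sym : symmetric E by move=> t t'; rewrite /E orbC.
have E_cl u t1 t2 t1' t2' : top sigma base (3 * rho) u t1 t2 ->
    top sigma base (3 * rho) u t1' t2' ->
    cl u t1 = cl u t1' -> cl u t2 = cl u t2' -> E t1 t2 = E t1' t2'.
  move=> t12 t12' e1 e2; congr (_ || _); first exact: (top_pair Wk anc det t12 t12').
  by apply: (top_pair Wk anc det (u := u)) => //; rewrite top_sym.
exists (lacon_of sigma base (3 * rho) cl E); split.
  move=> t t' tt'; rewrite -(lacon_of_correct sigma_inj E_sym E_cl).
  by change (out_adj t t' <-> E t t'); rewrite /out_adj tt'.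
have Wk3 u : #|wset sigma (3 * rho) u| <= kk by apply: wset_bound_mono Wk u; rewrite leq_mul2r orbT.
move=> r; have le : 3 * rho * r <= c * r by rewrite leq_mul2r /c leq_mul2r !orbT.
split.
  apply: leq_trans (col_lacon base cl E Wk3 v0 r) _.
  by rewrite leq_mul2l col_mono ?orbT.
apply: leq_trans (wcol_lacon base cl E Wk3 v0 r) _.
by rewrite leq_mul2l wcol_mono ?orbT.
Qed.
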